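(* Let $(U,\mu)$ be a fuzzy Hilbert space (satisfying the standing assumptions in the context), let $K_1,\dots,K_n$ be strongly fuzzy bounded linear operators on $U$, and let $\{f_i\}_{i=1}^\infty$ be a sequence in $U$ that is a fuzzy $K_j$-frame for $U$ for every $j=1,\dots,n$. Then: (i) for any scalars $a_1,\dots,a_n$, $\{f_i\}_{i=1}^\infty$ is a fuzzy $\big(\sum_{j=1}^na_jK_j\big)$-frame for $U$; (ii) $\{f_i\}_{i=1}^\infty$ is a fuzzy $\big(\prod_{j=1}^nK_j\big)$-frame for $U$, where $\prod_{j=1}^nK_j=K_1K_2\cdots K_n$.
   Context: Let $U$ be a complex vector space with zero vector $\theta$. A fuzzy inner product on $U$ is a map $\mu:U\times U\times\mathbb C\to[0,1]$ such that for all $x,y,z\in U$, $s,t\in\mathbb C$: (FIP1) $\mu(x+y,z,|t|+|s|)\ge\min\{\mu(x,z,|t|),\mu(y,z,|s|)\}$; (FIP2) $\mu(x,y,|st|)\ge\min\{\mu(x,x,|s|^2),\mu(y,y,|t|^2)\}$; (FIP3) $\mu(x,y,t)=\mu(y,x,\overline t)$; (FIP4) $\mu(cx,y,t)=\mu(x,y,t/|c|)$ for $c\in\mathbb C\setminus\{0\}$; (FIP5) $\mu(x,x,t)=0$ for $t\in\mathbb C\setminus\mathbb R^+$; (FIP6) $\mu(x,x,t)=1$ for all $t>0$ iff $x=\theta$; (FIP7) $\mu(x,x,\cdot):\mathbb R\to[0,1]$ is non-decreasing with limit $1$ at $+\infty$. Put $N(x,t)=\mu(x,x,t^2)$ for $t>0$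 and $N(x,t)=0$ for real $t\le0$. Standing assumptions: (FIP8) if $\mu(x,x,t^2)>0$ for all $t>0$ then $x=\theta$; (FIP9) the norms $\|x\|_\alpha=\inf\{t>0:N(x,t)\ge\alpha\}$, $\alpha\in(0,1)$ (the $\alpha$-norms, an ascending family of norms on $U$), satisfy the parallelogram law. Let $\langle\cdot,\cdot\rangle_\alpha$ be the inner product obtained from $\|\cdot\|_\alpha$ by polarization. $(U,\mu)$ is a fuzzy Hilbert space if $U$ is complete with respect to $\|\cdot\|_\alpha$ for every $\alpha\in(0,1)$. A linear operator $T$ on $U$ is strongly fuzzy bounded if there is $M>0$ with $N(Tx,s)\ge N(x,s/M)$ for all $x\in U,s\in\mathbb R$ (equivalently $\|Tx\|_\alpha\le M\|x\|_\alpha$ for all $x$ and all $\alpha\in(0,1)$, for some $M>0$). Every strongly fuzzy bounded linear operator $T$ on $U$ under consideration is taken to possess an adjoint $T^*$: a strongly fuzzy bounded linear operator on $U$ with $\langle x,Ty\rangle_\alpha=\langle T^*x,y\rangle_\alpha$ for all $x,y\in U$ and all $\alpha\in(0,1)$. For a strongly fuzzy bounded linear operator $K$ on $U$, a sequence $\{f_i\}_{i=1}^\infty$ in $U$ is a fuzzy $K$-frame for $U$ if there are constants $0<A\le B<\infty$ with $A\|K^*f\|_\alpha^2\le\sum_{i=1}^\infty|\langle f,f_i\rangle_\alpha|^2\le B\|f\|_\alpha^2$ for all $f\in U$ and all $\alpha\in(0,1)$. *)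

(* Defs.v *)
From mathcomp Require Import all_boot all_order all_algebra.
From mathcomp Require Import complex.
From mathcomp Require Import all_classical all_reals all_analysis.
Set Implicit Arguments.
Unset Strict Implicit.
Unset Printing Implicit Defensive.
Import Order.TTheory GRing.Theory Num.Theory.
Import numFieldNormedType.Exports.
Local Open Scope classical_set_scope.
Local Open Scope complex_scope.
Local Open Scope ring_scope.

(* On R[i], `|z| and the order are those of a numClosedFieldType: `|z| is the
   modulus as an element of R[i], and [0 < t] says that t is real and positive,
   so that [~~ (0 < t)] in fip5 means that t is outside of R^+. *)
Record fuzzy_inner_product (R : realType) (U : lmodType R[i])
    (mu : U -> U -> R[i] -> R) : Prop := FuzzyInnerProduct {
  fip_range : forall x y t, 0 <= mu x y t <= 1 ;
  fip1 : forall x y z (s t : R[i]),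
    Num.min (mu x z `|t|) (mu y z `|s|) <= mu (x + y) z (`|t| + `|s|) ;
  fip2 : forall x y (s t : R[i]),
    Num.min (mu x x (`|s| ^+ 2)) (mu y y (`|t| ^+ 2)) <= mu x y `|s * t| ;
  fip3 : forall x y (t : R[i]), mu x y t = mu y x (t^*)%C ;
  fip4 : forall x y (t c : R[i]), c != 0 -> mu (c *: x) y t = mu x y (t / `|c|) ;
  fip5 : forall x (t : R[i]), ~~ (0 < t) -> mu x x t = 0 ;
  fip6 : forall x, (forall t : R, 0 < t -> mu x x t%:C = 1) <-> x = 0 ;
  fip7_mono : forall x, {homo (fun t : R => mu x x t%:C) : s t / s <= t} ;
  fip7_lim : forall x, (fun t : R => mu x x t%:C) @ +oo --> (1 : R) }.

Section FuzzyHilbert.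
Context (R : realType) (U : lmodType R[i]) (mu : U -> U -> R[i] -> R).

Definition fuzzy_norm (x : U) (t : R) : R :=
  if 0 < t then mu x x (t ^+ 2)%:C else 0.

Definition fip8 : Prop :=
  forall x : U, (forall t : R, 0 < t -> 0 < mu x x (t ^+ 2)%:C) -> x = 0.

Definition alpha_norm (alpha : R) (x : U) : R :=
  inf [set t : R | 0 < t /\ alpha <= fuzzy_norm x t].

Definition fip9 : Prop :=
  forall alpha : R, 0 < alpha < 1 -> forall x y : U,
  alpha_norm alpha (x + y) ^+ 2 + alpha_norm alpha (x - y) ^+ 2 =
  2 * (alpha_norm alpha x ^+ 2 + alpha_norm alpha y ^+ 2).

(* Polarization, linear in the first argument. *)
Definition alpha_inner (alpha : R) (x y : U) : R[i] :=
  4^-1 * ((alpha_norm alpha (x + y) ^+ 2)%:C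
          - (alpha_norm alpha (x - y) ^+ 2)%:C
          + 'i%C * (alpha_norm alpha (x + 'i%C *: y) ^+ 2)%:C
          - 'i%C * (alpha_norm alpha (x - 'i%C *: y) ^+ 2)%:C).

Definition alpha_cauchy (alpha : R) (u : nat -> U) : Prop :=
  forall e : R, 0 < e -> exists n0 : nat, forall m n : nat,
    (n0 <= m)%N -> (n0 <= n)%N -> alpha_norm alpha (u m - u n) < e.

Definition alpha_converges (alpha : R) (u : nat -> U) (x : U) : Prop :=
  forall e : R, 0 < e -> exists n0 : nat, forall n : nat,
    (n0 <= n)%N -> alpha_norm alpha (u n - x) < e.

Definition alpha_complete (alpha : R) : Prop :=
  forall u : nat -> U, alpha_cauchy alpha u ->
    exists x : U, alpha_converges alpha u x.

Record fuzzy_hilbert_space : Prop := FuzzyHilbertSpace {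
  fhs_fip : fuzzy_inner_product mu ;
  fhs_fip8 : fip8 ;
  fhs_fip9 : fip9 ;
  fhs_complete : forall alpha : R, 0 < alpha < 1 -> alpha_complete alpha }.

Definition strongly_fuzzy_bounded (T : U -> U) : Prop :=
  exists M : R, 0 < M /\
    forall (x : U) (s : R), fuzzy_norm x (s / M) <= fuzzy_norm (T x) s.

Definition sfb_operator (T : U -> U) : Prop :=
  linear T /\ strongly_fuzzy_bounded T.

Definition is_fuzzy_adjoint (T Tstar : U -> U) : Prop :=
  sfb_operator Tstar /\
  forall alpha : R, 0 < alpha < 1 -> forall x y : U,
    alpha_inner alpha x (T y) = alpha_inner alpha (Tstar x) y.

(* The adjoint is unique when it exists, because each alpha_inner is definite;
   the existential on Kstar therefore only names K^*.  The series has
   nonnegative terms and is valued in \bar R, so the upper bound includes its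
   convergence. *)
Definition fuzzy_K_frame (K : U -> U) (f : nat -> U) : Prop :=
  sfb_operator K /\
  exists2 Kstar : U -> U, is_fuzzy_adjoint K Kstar &
  exists A B : R, 0 < A /\ A <= B /\
    forall alpha : R, 0 < alpha < 1 -> forall g : U,
      ((A * alpha_norm alpha (Kstar g) ^+ 2)%:E <=
        \sum_(0 <= i <oo) (Normc.normc (alpha_inner alpha g (f i)) ^+ 2)%:E)%E /\
      (\sum_(0 <= i <oo) (Normc.normc (alpha_inner alpha g (f i)) ^+ 2)%:E <=
        (B * alpha_norm alpha g ^+ 2)%:E)%E.

End FuzzyHilbert.

(* Main.v *)
(** The parallelogram law makes each alpha-inner product sesquilinear
    (Jordan-von Neumann), so adjoints of combinations and of products are the
    expected ones.  For (i), with [q = ||.||^2], [q (x + y) <= 2 (q x + q y)]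
    turns the lower frame bounds of [K] and [L] into one for [a K + L].  For
    (ii), [(K T)^* = T^* K^*] and boundedness of [T^*] reduce the lower frame
    bound of [K T] to the one of [K]. *)
Require Import Defs.
From mathcomp Require Import all_boot all_order all_algebra.
From mathcomp Require Import complex.
From mathcomp Require Import all_classical all_reals all_analysis.
From mathcomp Require Import ring lra.
Set Implicit Arguments.
Unset Strict Implicit.
Unset Printing Implicit Defensive.
Import Order.TTheory GRing.Theory Num.Theory.
Local Open Scope ring_scope.

(** * Sesquilinearity of the polarization of a squared norm satisfying the parallelogram law *)

Section JordanVonNeumann.
Local Open Scope complex_scope.
Context (R : realType) (U : lmodType R[i]) (q : U -> R).
Hypothesis q_ge0 : forall x, 0 <= q x.
Hypothesis qZ : forall (c : R[i]) x, q (c *: x) = Normc.normc c ^+ 2 * q x.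
Hypothesis q_parallelogram :
  forall x y, q (x + y) + q (x - y) = 2 * (q x + q y).

Let B (x y : U) : R := (q (x + y) - q (x - y)) / 4.

Let normcC (t : R) : Normc.normc t%:C = `|t|.
Proof. by rewrite /Normc.normc /= expr0n addr0 sqrtr_sqr. Qed.

Let qN x : q (- x) = q x.
Proof.
have := qZ (-1)%:C x; rewrite normcC normrN1 expr1n mul1r.
by rewrite rmorphN1 scaleN1r.
Qed.

Let qi x : q ('i%C *: x) = q x.
Proof.
by rewrite qZ /Normc.normc /= expr0n add0r expr1n sqrtr1 expr1n mul1r.
Qed.

Let BC x y : B x y = B y x.
Proof. by rewrite /B (addrC y) -(opprB x y) qN. Qed.

Let B0 y : B 0 y = 0.
Proof. by rewrite /B add0r sub0r qN subrr mul0r. Qed.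

Let BN x y : B (- x) y = - B x y.
Proof.
rewrite /B -(qN (- x + y)) -(qN (- x - y)) !opprD !opprK.
by rewrite -mulNr opprB.
Qed.

(** Subtract the parallelogram laws for the pairs [x + y], [x' + y] and [x - y], [x' - y]: both
    contain [q (x - x')], which cancels. *)
Let B_half x x' y : B x y + B x' y = B (x + x') (y + y) / 2.
Proof.
rewrite /B.
have h1 := q_parallelogram (x + y) (x' + y).
have h2 := q_parallelogram (x - y) (x' - y).
rewrite (_ : x + y + (x' + y) = x + x' + (y + y)) in h1; last first.
  by rewrite addrACA.
rewrite (_ : x + y - (x' + y) = x - x') in h1; last first.
  by rewrite opprD addrACA subrr addr0.
rewrite (_ : x - y + (x' - y) = x + x' - (y + y)) in h2; last first.
  by rewrite addrACA opprD.
rewrite (_ : x - y - (x' - y) = x - x') in h2; last first.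
  by rewrite opprB addrA subrK.
lra.
Qed.

(** The right-hand side of [B_half] depends on [x + x'] alone, so the pairs [x], [x'] and [x + x'],
    [0] give the same value. *)
Let BDl x x' y : B (x + x') y = B x y + B x' y.
Proof.
have h := B_half (x + x') 0 y.
by rewrite B0 !addr0 in h; rewrite B_half.
Qed.

Let BMn x y n : B (x *+ n) y = B x y *+ n.
Proof. by elim: n => [|n ih]; rewrite ?mulr0n ?B0// !mulrS BDl ih. Qed.

Let BMz x y (m : int) : B (m%:~R *: x) y = m%:~R * B x y.
Proof.
case: m => n; first by rewrite scaler_nat BMn mulr_natl.
by rewrite NegzE !mulrNz scaleNr BN scaler_nat BMn mulNr mulr_natl.
Qed.

(** The two terms of [B] are nonnegative with sum at most [2 * (q x + q y)], which therefore also
    bounds their difference. *)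
Let B_bounded (t : R) x y : 0 <= t <= 1 -> `|B (t%:C *: x) y| <= (q x + q y) / 2.
Proof.
move=> /andP[t0 t1]; have h := q_parallelogram (t%:C *: x) y.
rewrite qZ normcC ger0_norm// in h.
have t2 : t ^+ 2 * q x <= q x by apply: ler_piMl => //; exact: exprn_ile1.
have p1 := q_ge0 (t%:C *: x + y); have p2 := q_ge0 (t%:C *: x - y).
by rewrite /B ler_norml; apply/andP; split; lra.
Qed.

(* [t |-> B (t x) y - t B x y] is additive, vanishes on the integers and is
   bounded on [0, 1]; hence it is bounded, hence zero. *)
Let BZl (t : R) x y : B (t%:C *: x) y = t * B x y.
Proof.
pose g (s : R) := B (s%:C *: x) y - s * B x y.
have gD s s' : g (s + s') = g s + g s'.
  by rewrite /g rmorphD scalerDl BDl; ring.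
have gz (m : int) : g m%:~R = 0.
  by rewrite /g rmorph_int BMz subrr.
have gMn s n : g (s *+ n) = g s *+ n.
  elim: n => [|n ih]; first by rewrite !mulr0n (gz 0).
  by rewrite !mulrS gD ih.
pose C := (q x + q y) / 2 + `|B x y|.
have gC s : `|g s| <= C.
  have -> : g s = g (s - (Num.floor s)%:~R).
    have := gD (s - (Num.floor s)%:~R) (Num.floor s)%:~R.
    by rewrite subrK gz addr0.
  set r := s - _.
  have r01 : 0 <= r <= 1.
    have := Num.Theory.floor_itv s; rewrite /r intrD => /andP[? ?].
    by apply/andP; split; lra.
  rewrite /g (le_trans (ler_normB _ _))// lerD ?B_bounded//.
  by rewrite normrM ler_piMl//; move: r01 => /andP[? ?]; rewrite ger0_norm.
apply/eqP; rewrite -subr_eq0 -/(g t) -normr_le0 leNgt; apply/negP => gt0.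
have C0 : 0 <= C / `|g t|.
  by rewrite divr_ge0// (le_trans _ (gC 0)).
have := Num.Theory.archi_boundP C0; set n := Num.bound _ => Cn.
have := gC (t *+ n); rewrite gMn normrMn -mulr_natl leNgt.
by rewrite -ltr_pdivrMr// Cn.
Qed.

Let Bi x y : B ('i%C *: x) ('i%C *: y) = B x y.
Proof. by rewrite /B -scalerDr -scalerBr !qi. Qed.

Let sqr_i : 'i%C * 'i%C = -1 :> R[i].
Proof. by rewrite -expr2 sqr_i. Qed.

(** Multiplying both arguments by ['i] preserves [B]; on the left this produces the square of ['i],
    hence the sign. *)
Let Bil x y : B ('i%C *: x) y = - B x ('i%C *: y).
Proof. by rewrite -Bi scalerA sqr_i scaleN1r BN. Qed.

(** For [q] the square of [alpha_norm] this is convertible to [alpha_inner], so the lemmas below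
    transfer to it directly. *)
Definition polarization (x y : U) : R[i] :=
  4^-1 * ((q (x + y))%:C - (q (x - y))%:C
          + 'i%C * (q (x + 'i%C *: y))%:C - 'i%C * (q (x - 'i%C *: y))%:C).

Let polarizationE x y : polarization x y = (B x y)%:C + 'i%C * (B x ('i%C *: y))%:C.
Proof.
rewrite /polarization /B !rmorphM !rmorphB/= fmorphV rmorph_nat.
ring.
Qed.

Lemma polarizationDl x x' y :
  polarization (x + x') y = polarization x y + polarization x' y.
Proof. by rewrite !polarizationE !BDl !rmorphD/=; ring. Qed.

(** Split [c] into real and imaginary parts: [BZl] extracts the real factors, while [Bil] and [Bi]
    absorb ['i]. *)
Lemma polarizationZl (c : R[i]) x y :
  polarization (c *: x) y = c * polarization x y.
Proof.
pose a := complex.Re c; pose b := complex.Im c.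
have -> : c = a%:C + 'i%C * b%:C by exact: complexE.
rewrite scalerDl -scalerA !polarizationE !BDl Bil Bi !BZl.
by apply/eqP; rewrite eq_complex /=; apply/andP; split; apply/eqP; ring.
Qed.

Lemma polarizationC x y : polarization y x = ((polarization x y)^*)%C.
Proof.
rewrite !polarizationE (BC y x) (BC y ('i%C *: x)) Bil.
by apply/eqP; rewrite eq_complex /=; apply/andP; split; apply/eqP; ring.
Qed.

Lemma polarizationDr x y y' :
  polarization x (y + y') = polarization x y + polarization x y'.
Proof. by rewrite !(polarizationC _ x) polarizationDl rmorphD. Qed.

Lemma polarizationZr (c : R[i]) x y :
  polarization x (c *: y) = (c^*)%C * polarization x y.
Proof. by rewrite !(polarizationC _ x) polarizationZl rmorphM. Qed.

End JordanVonNeumann.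

(** * The fuzzy norm, strongly fuzzy bounded operators and the alpha-norms *)

Section FuzzyHilbertOperators.
Context (R : realType) (U : lmodType R[i]) (mu : U -> U -> R[i] -> R).
Hypothesis hmu : fuzzy_inner_product mu.

Local Notation N := (fuzzy_norm mu).
Local Notation anorm := (alpha_norm mu).
Local Notation normc := (@Normc.normc R).

Lemma normrE (c : R[i]) : `|c| = (normc c)%:C%C.
Proof. by case: c. Qed.

Lemma normc_gt0 (c : R[i]) : (0 < normc c) = (c != 0).
Proof. by rewrite -normr_gt0 normrE ltcR. Qed.

Lemma fuzzy_norm_range x s : 0 <= N x s <= 1.
Proof.
by rewrite /fuzzy_norm; case: ifP; rewrite ?lexx ?ler01// (fip_range hmu).
Qed.

Lemma fuzzy_norm0 s : 0 < s -> N 0 s = 1.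
Proof.
move=> s0; rewrite /fuzzy_norm s0.
by apply: (fip6 hmu 0).2 => //; rewrite exprn_gt0.
Qed.

(** [fip4] frees the first argument from [c], and after the swap [fip3] also the second; the
    conjugation is harmless at a real parameter. The two divisions make up the square of
    [normc c]. *)
Lemma fuzzy_normZ (c : R[i]) x s : c != 0 -> N (c *: x) s = N x (s / normc c).
Proof.
move=> c0; have n0 : 0 < normc c by rewrite normc_gt0.
rewrite /fuzzy_norm pmulr_lgt0 ?invr_gt0//; case: ifP => // s0.
have mv (y : U) (t : R) : mu (c *: x) y t%:C%C = mu x y (t / normc c)%:C%C.
  by rewrite (fip4 hmu)// normrE rmorphM/= fmorphV.
rewrite mv (fip3 hmu) conjc_real mv.
by congr (mu _ _ _%:C%C); field; exact: lt0r_neq0.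
Qed.

(** Expand [(s + t) ^+ 2] as [s ^+ 2 + s * t + s * t + t ^+ 2]: [fip1] distributes these over the
    four terms of the pair [x + y], [x + y], and [fip2] bounds the mixed ones. *)
Lemma fuzzy_normD x y s t : 0 < s -> 0 < t ->
  Num.min (N x s) (N y t) <= N (x + y) (s + t).
Proof.
move=> s0 t0; rewrite /fuzzy_norm s0 t0 addr_gt0//.
have absC (r : R) : 0 < r -> `|r%:C%C| = r%:C%C.
  by move=> r0; rewrite gtr0_norm// ltcR.
have mu1 (u v w : U) (a b : R) : 0 < a -> 0 < b ->
    Num.min (mu u w a%:C%C) (mu v w b%:C%C) <= mu (u + v) w (a + b)%:C%C.
  move=> a0 b0; have := fip1 hmu u v w b%:C%C a%:C%C.
  by rewrite !absC// -rmorphD.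
have mu2 (u v : U) (a b : R) : 0 < a -> 0 < b ->
    Num.min (mu u u (a ^+ 2)%:C%C) (mu v v (b ^+ 2)%:C%C) <= mu u v (a * b)%:C%C.
  move=> a0 b0; have := fip2 hmu u v a%:C%C b%:C%C.
  by rewrite -rmorphM/= !absC ?mulr_gt0// -!rmorphXn.
have muC (u v : U) (a : R) : mu u v a%:C%C = mu v u a%:C%C.
  by rewrite (fip3 hmu) conjc_real.
set m := Num.min _ _.
have /andP[m1 m2] : (m <= mu x x (s ^+ 2)%:C%C) && (m <= mu y y (t ^+ 2)%:C%C).
  by rewrite -le_min.
have mx : m <= mu x (x + y) (s ^+ 2 + s * t)%:C%C.
  rewrite muC; apply: le_trans (mu1 _ _ _ _ _ _ _); rewrite ?exprn_gt0 ?mulr_gt0//.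
  rewrite le_min m1/= mulrC.
  by apply: le_trans (mu2 _ _ _ _ t0 s0); rewrite le_min m1 m2.
have my : m <= mu y (x + y) (s * t + t ^+ 2)%:C%C.
  rewrite muC; apply: le_trans (mu1 _ _ _ _ _ _ _); rewrite ?exprn_gt0 ?mulr_gt0//.
  by rewrite le_min m2 andbT; exact: mu2.
have -> : (s + t) ^+ 2 = (s ^+ 2 + s * t) + (s * t + t ^+ 2) by ring.
apply: le_trans (mu1 _ _ _ _ _ _ _); rewrite ?le_min ?mx//;
  by rewrite addr_gt0// ?exprn_gt0 ?mulr_gt0.
Qed.

(** Makes the set in [alpha_norm] nonempty, so that its [inf] is a genuine infimum. *)
Lemma fuzzy_norm_reaches (alpha : R) x :
  alpha < 1 -> exists t, 0 < t /\ alpha <= N x t.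
Proof.
move=> a1.
have [M [_ hM]] := cvgr_gt _ (fip7_lim hmu x) alpha a1.
(* This [t] exceeds [M] and is at least 1, so its square, at which [mu] is evaluated, exceeds [M]
   too. *)
pose t := Num.max M 0 + 1.
have M0 : M <= Num.max M 0 /\ 0 <= Num.max M 0 by rewrite !le_max !lexx orbT.
have t0 : 0 < t by rewrite /t; lra.
exists t; split => //; rewrite /fuzzy_norm t0 ltW// hM//.
by rewrite /t; nra.
Qed.

Lemma strongly_fuzzy_bounded_comp (S T : U -> U) :
  strongly_fuzzy_bounded mu S -> strongly_fuzzy_bounded mu T ->
  strongly_fuzzy_bounded mu (S \o T).
Proof.
move=> [M [M0 hS]] [L [L0 hT]]; exists (M * L); split; first exact: mulr_gt0.
move=> x s; apply: le_trans (hS _ _); apply: le_trans (hT _ _).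
by rewrite invfM mulrA.
Qed.

Lemma strongly_fuzzy_bounded0 : strongly_fuzzy_bounded mu (fun=> 0).
Proof.
exists 1; split => // x s; rewrite divr1.
case: (ltP 0 s) => [s0|s0]; last by rewrite /fuzzy_norm ltNge s0.
by rewrite fuzzy_norm0//; case/andP: (fuzzy_norm_range x s).
Qed.

Lemma strongly_fuzzy_boundedZ (c : R[i]) :
  strongly_fuzzy_bounded mu ( *:%R c).
Proof.
(* The constant must be positive, so [normc c] serves only for nonzero [c]. *)
have [->|c0] := eqVneq c 0.
  have [M [M0 hM]] := strongly_fuzzy_bounded0.
  by exists M; split => // x s; rewrite scale0r.
exists (normc c); split; first by rewrite normc_gt0.
by move=> x s; rewrite fuzzy_normZ.
Qed.

Lemma strongly_fuzzy_boundedD (S T : U -> U) :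
  strongly_fuzzy_bounded mu S -> strongly_fuzzy_bounded mu T ->
  strongly_fuzzy_bounded mu (fun x => S x + T x).
Proof.
move=> [M [M0 hS]] [L [L0 hT]].
have ML : 0 < M + L by exact: addr_gt0.
exists (M + L); split => // x s.
case: (ltP 0 s) => [s0|s0]; last first.
  rewrite [leLHS]/fuzzy_norm pmulr_lgt0 ?invr_gt0// ltNge s0/=.
  by case/andP: (fuzzy_norm_range (S x + T x) s).
(* Splitting [s] as [M * u + L * u] makes both bounds refer to the same value [N x u]. *)
set u := s / (M + L); have u0 : 0 < u by exact: divr_gt0.
have -> : s = M * u + L * u by rewrite /u; field; exact: lt0r_neq0.
apply: le_trans (fuzzy_normD _ _ (mulr_gt0 M0 u0) (mulr_gt0 L0 u0)).
have cancel_u (P : R) : 0 < P -> P * u / P = u.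
  by move=> P0; rewrite mulrAC divff ?mul1r// lt0r_neq0.
have := hS x (M * u); have := hT x (L * u).
by rewrite !cancel_u// le_min => -> ->.
Qed.

Lemma alpha_norm_ge0 alpha x : 0 <= anorm alpha x.
Proof.
rewrite /alpha_norm; set A := [set t | _]%classic.
(* By convention the [inf] of the empty set is 0. *)
have [->|/set0P A0] := eqVneq A set0; first by rewrite inf0.
by apply: lb_le_inf => // t [t0 _]; exact: ltW.
Qed.

(** If [t] is admissible in the infimum for [x], then [M * t] is admissible in that for [y]. Two
    independent vectors let this cover both operators and scalar multiples. *)
Lemma alpha_norm_le (alpha M : R) x y : alpha < 1 -> 0 < M ->
  (forall s, N x (s / M) <= N y s) -> anorm alpha y <= M * anorm alpha x.
Proof.
move=> a1 M0 xy; rewrite mulrC -ler_pdivrMr//.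
apply: lb_le_inf; first by have [t ht] := fuzzy_norm_reaches x a1; exists t.
move=> t [t0 at_]; rewrite ler_pdivrMr//; apply: ge_inf.
  by exists 0 => r [r0 _]; exact: ltW.
split; first exact: mulr_gt0.
by rewrite (le_trans at_)// (le_trans _ (xy _))// mulfK// lt0r_neq0.
Qed.

Lemma strongly_fuzzy_bounded_alpha_norm (T : U -> U) :
  strongly_fuzzy_bounded mu T ->
  exists2 M, 0 < M & forall alpha x, 0 < alpha < 1 ->
    anorm alpha (T x) <= M * anorm alpha x.
Proof.
move=> [M [M0 hT]]; exists M => // alpha x /andP[_ a1].
exact: alpha_norm_le.
Qed.

(** Rescaling the parameter does not change the fuzzy norm of 0, so its alpha-norm is at most half
    of itself. *)
Lemma alpha_norm0 alpha : alpha < 1 -> anorm alpha 0 = 0.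
Proof.
move=> a1; have : anorm alpha 0 <= 2^-1 * anorm alpha 0.
  apply: alpha_norm_le; rewrite ?invr_gt0// => s; rewrite invrK.
  have [s0|s0] := ltP 0 s; first by rewrite !fuzzy_norm0// mulr_gt0.
  by rewrite /fuzzy_norm pmulr_lgt0// ltNge s0.
by have := alpha_norm_ge0 alpha 0; lra.
Qed.

Lemma alpha_normZ alpha (c : R[i]) x : alpha < 1 ->
  anorm alpha (c *: x) = normc c * anorm alpha x.
Proof.
move=> a1; have [->|c0] := eqVneq c 0.
  by rewrite scale0r alpha_norm0// Normc.normc0 mul0r.
have n0 : 0 < normc c by rewrite normc_gt0.
apply/eqP; rewrite eq_le; apply/andP; split.
  by apply: alpha_norm_le => // s; rewrite fuzzy_normZ.
rewrite mulrC -ler_pdivlMr// mulrC.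
apply: alpha_norm_le; rewrite ?invr_gt0// => s.
by rewrite fuzzy_normZ// invrK mulfK// lt0r_neq0.
Qed.

End FuzzyHilbertOperators.

(** * Alpha-inner products, adjoints and stability of frames *)

Section FuzzyFrames.
Context (R : realType) (U : lmodType R[i]) (mu : U -> U -> R[i] -> R).
Hypothesis hU : fuzzy_hilbert_space mu.

Let hmu : fuzzy_inner_product mu := fhs_fip hU.

Local Notation anorm := (alpha_norm mu).
Local Notation inner := (alpha_inner mu).
Local Notation normc := (@Normc.normc R).

Let sqZ alpha : 0 < alpha < 1 -> forall (c : R[i]) x,
  anorm alpha (c *: x) ^+ 2 = normc c ^+ 2 * anorm alpha x ^+ 2.
Proof. by move=> /andP[_ a1] c x; rewrite (alpha_normZ hmu)// exprMn. Qed.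

Lemma alpha_innerDl alpha x x' y : 0 < alpha < 1 ->
  inner alpha (x + x') y = inner alpha x y + inner alpha x' y.
Proof.
move=> a01; exact: (@polarizationDl _ _ (fun x => anorm alpha x ^+ 2)
  (sqZ a01) (fhs_fip9 hU a01)).
Qed.

Lemma alpha_innerDr alpha x y y' : 0 < alpha < 1 ->
  inner alpha x (y + y') = inner alpha x y + inner alpha x y'.
Proof.
move=> a01; exact: (@polarizationDr _ _ (fun x => anorm alpha x ^+ 2)
  (sqZ a01) (fhs_fip9 hU a01)).
Qed.

Lemma alpha_innerZl alpha (c : R[i]) x y : 0 < alpha < 1 ->
  inner alpha (c *: x) y = c * inner alpha x y.
Proof.
move=> a01; exact: (@polarizationZl _ _ (fun x => anorm alpha x ^+ 2)
  (fun=> sqr_ge0 _) (sqZ a01) (fhs_fip9 hU a01)).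
Qed.

Lemma alpha_innerZr alpha (c : R[i]) x y : 0 < alpha < 1 ->
  inner alpha x (c *: y) = (c^*)%C * inner alpha x y.
Proof.
move=> a01; exact: (@polarizationZr _ _ (fun x => anorm alpha x ^+ 2)
  (fun=> sqr_ge0 _) (sqZ a01) (fhs_fip9 hU a01)).
Qed.

Lemma sfb_operator_comp (S T : U -> U) :
  sfb_operator mu S -> sfb_operator mu T -> sfb_operator mu (S \o T).
Proof.
move=> [lS bS] [lT bT]; split; last exact: strongly_fuzzy_bounded_comp.
by move=> c x y /=; rewrite lT lS.
Qed.

Lemma sfb_operator0 : sfb_operator mu (fun=> 0).
Proof.
split; last exact: strongly_fuzzy_bounded0.
by move=> c x y /=; rewrite scaler0 addr0.
Qed.

Lemma sfb_operator_linear (c : R[i]) (S T : U -> U) :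
  sfb_operator mu S -> sfb_operator mu T ->
  sfb_operator mu (fun x => c *: S x + T x).
Proof.
move=> [lS bS] [lT bT]; split; last first.
  apply: strongly_fuzzy_boundedD => //.
  exact: (strongly_fuzzy_bounded_comp (strongly_fuzzy_boundedZ hmu c)).
move=> k x y /=; rewrite lT lS !scalerDr !scalerA (mulrC c k).
by rewrite addrACA.
Qed.

Lemma is_fuzzy_adjoint_comp (S T S' T' : U -> U) :
  is_fuzzy_adjoint mu S S' -> is_fuzzy_adjoint mu T T' ->
  is_fuzzy_adjoint mu (S \o T) (T' \o S').
Proof.
move=> [bS aS] [bT aT]; split; first exact: sfb_operator_comp.
by move=> alpha a01 x y /=; rewrite aS// aT.
Qed.

Lemma is_fuzzy_adjoint0 : is_fuzzy_adjoint mu (fun=> 0) (fun=> 0).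
Proof.
split=> [|alpha a01 x y]; first exact: sfb_operator0.
rewrite -[X in inner alpha x X](scale0r 0) alpha_innerZr//.
by rewrite -[X in inner alpha X y](scale0r 0) alpha_innerZl// conjc0 !mul0r.
Qed.

(** The conjugate arises because [alpha_inner] is conjugate-linear in its second argument. *)
Lemma is_fuzzy_adjoint_linear (c : R[i]) (S T S' T' : U -> U) :
  is_fuzzy_adjoint mu S S' -> is_fuzzy_adjoint mu T T' ->
  is_fuzzy_adjoint mu (fun x => c *: S x + T x)
    (fun x => (c^*)%C *: S' x + T' x).
Proof.
move=> [bS aS] [bT aT]; split; first exact: sfb_operator_linear.
move=> alpha a01 x y.
by rewrite alpha_innerDr// alpha_innerDl// alpha_innerZr// alpha_innerZl// aS// aT.
Qed.

Variable f : nat -> U.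

Lemma fuzzy_K_frame_comp (K T : U -> U) :
  fuzzy_K_frame mu K f -> sfb_operator mu T ->
  (exists T', is_fuzzy_adjoint mu T T') -> fuzzy_K_frame mu (K \o T) f.
Proof.
move=> [bK [K' aK [A [B [A0 [AB hK]]]]]] bT [T' aT].
split; first exact: sfb_operator_comp.
exists (T' \o K'); first exact: is_fuzzy_adjoint_comp.
have [M M0 hM] := strongly_fuzzy_bounded_alpha_norm hmu aT.1.2.
(* Dividing [A] by [1 + M ^+ 2] absorbs the factor [M ^+ 2] from [T'] and also keeps the new lower
   constant below [A], hence below [B]. *)
have M1 : 1 <= 1 + M ^+ 2 by rewrite lerDl sqr_ge0.
have M1_gt0 : 0 < 1 + M ^+ 2 by exact: lt_le_trans M1.
have hA : A / (1 + M ^+ 2) <= A by rewrite ler_pdivrMr// ler_peMr// ltW.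
exists (A / (1 + M ^+ 2)), B; split; first exact: divr_gt0.
split; first exact: le_trans hA AB.
move=> alpha a01 g; have [lo hi] := hK alpha a01 g.
split => //; apply: le_trans lo; rewrite lee_fin mulrAC ler_pdivrMr//.
rewrite -mulrA ler_pM2l//=.
have := hM alpha (K' g) a01; have := alpha_norm_ge0 mu alpha (T' (K' g)).
nra.
Qed.

(** Base case for sums: the bounds [A] and [B] of [K] are kept, the lower one becoming nonnegativity
    of the series. *)
Lemma fuzzy_K_frame0 (K : U -> U) :
  fuzzy_K_frame mu K f -> fuzzy_K_frame mu (fun=> 0) f.
Proof.
move=> [_ [K' _ [A [B [A0 [AB hK]]]]]]; split; first exact: sfb_operator0.
exists (fun=> 0); first exact: is_fuzzy_adjoint0.
exists A, B; do 2 split => //; move=> alpha a01 g.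
split; last exact: (hK alpha a01 g).2.
rewrite (alpha_norm0 hmu) ?expr0n ?mulr0; last by case/andP: a01.
by apply: nneseries_ge0 => i _ _; rewrite lee_fin sqr_ge0.
Qed.

Lemma fuzzy_K_frame_linear (c : R[i]) (K L : U -> U) :
  fuzzy_K_frame mu K f -> fuzzy_K_frame mu L f ->
  fuzzy_K_frame mu (fun x => c *: K x + L x) f.
Proof.
move=> [bK [K' aK [A1 [B1 [A10 [_ hK]]]]]] [bL [L' aL [A2 [B [A20 [A2B hL]]]]]].
split; first exact: sfb_operator_linear.
exists (fun x => (c^*)%C *: K' x + L' x); first exact: is_fuzzy_adjoint_linear.
set k := normc (c^*)%C ^+ 2; have k0 : 0 <= k by exact: sqr_ge0.
have kA : 0 <= k * A2 by rewrite mulr_ge0// ltW.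
(* Weighting the lower bounds of [K] and [L] by [2 * k * A2] and [2 * A1] and adding gives
   [2 * A1 * A2 * (k * x + y) <= D * s], with [x], [y] the squared norms of [K' g], [L' g] and [s]
   the series. Since [B] comes from [L], the new constant is compared with [A2]. *)
pose D := 2 * (k * A2 + A1); have D0 : 0 < D by rewrite /D; lra.
have hA : A1 * A2 / D <= A2 by rewrite ler_pdivrMr// /D; nra.
exists (A1 * A2 / D), B; split; first by rewrite divr_gt0// mulr_gt0.
split; first exact: le_trans hA A2B.
move=> alpha a01 g; have [lo1 _] := hK alpha a01 g.
have [] := hL alpha a01 g; move: lo1.
(* The frame bounds rule out infinite values, leaving a real number [s]. *)
case: (\sum_(0 <= i <oo) _)%E => // s; rewrite !lee_fin => lo1 lo2 hi.
split => //; rewrite mulrAC ler_pdivrMr//.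
have := fhs_fip9 hU a01 ((c^*)%C *: K' g) (L' g); rewrite sqZ// -/k.
have := sqr_ge0 (anorm alpha ((c^*)%C *: K' g - L' g)).
set q := anorm alpha (_ + _) ^+ 2; set x := anorm alpha (K' g) ^+ 2.
set y := anorm alpha (L' g) ^+ 2 => d0 par.
have q_le : q <= 2 * (k * x + y) by lra.
have A12 : 0 <= A1 * A2 by rewrite mulr_ge0 ?ltW.
apply: (le_trans (ler_wpM2l A12 q_le)).
rewrite -/x in lo1; rewrite -/y in lo2.
have h1 := ler_wpM2l kA lo1; have h2 := ler_wpM2l (ltW A10) lo2.
by rewrite /D; lra.
Qed.

End FuzzyFrames.

Theorem theorem3p15 (R : realType) (U : lmodType R[i])
    (mu : U -> U -> R[i] -> R) (hU : fuzzy_hilbert_space mu)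
    (n : nat) (hn : (0 < n)%N) (K : 'I_n -> U -> U)
    (hK : forall j, sfb_operator mu (K j))
    (hKadj : forall j, exists Kstar : U -> U, is_fuzzy_adjoint mu (K j) Kstar)
    (f : nat -> U) (hf : forall j, fuzzy_K_frame mu (K j) f) :
  (forall a : 'I_n -> R[i],
     fuzzy_K_frame mu (fun x : U => \sum_(j < n) a j *: K j x) f) /\
  fuzzy_K_frame mu (\big[comp/id]_(j < n) K j) f.
Proof.
case: n hn K hK hKadj hf => [//|n] _ K hK hKadj hf; split=> [a|].
  (* Induction on the list of indices; the empty sum is the zero operator, which borrows the frame
     bounds of [K ord0]. *)
  elim: (index_enum _) => [|j r ih].
    rewrite (_ : (fun _ => _) = fun=> 0); first exact: fuzzy_K_frame0 (hf ord0).
    by apply/funext => x; rewrite big_nil.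
  rewrite (_ : (fun _ => _) = fun x => a j *: K j x + \sum_(i <- r) a i *: K i x).
    exact: fuzzy_K_frame_linear.
  by apply/funext => x; rewrite big_cons.
(* The outermost factor [K ord0] carries the frame property, and the product of the others plays the
   part of [T]. Bounded operators and operators with an adjoint both contain [id] and are closed
   under composition. *)
rewrite big_ord_recl; apply: fuzzy_K_frame_comp => //.
  apply: (big_ind (sfb_operator mu)) => //; last exact: sfb_operator_comp.
  by split=> //; exists 1; split => // x s; rewrite divr1.
apply: (big_ind (fun T => exists T', is_fuzzy_adjoint mu T T')) => //.
  exists id; split => //; split=> //.
  by exists 1; split => // x s; rewrite divr1.
by move=> S T [S' hS] [T' hT]; exists (T' \o S'); exact: is_fuzzy_adjoint_comp.
Qed.
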